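(* Let $\mathcal V$ be a quantale, $F\colon\mathsf{Set}\to\mathsf{Set}$ a functor, $\widehat F$ a lax extension of $F$ to $\mathcal V\text{-}\mathsf{Rel}$, $\kappa$ a cardinal, and $\mu$ a $\kappa$-ary predicate lifting for $F$. Then $\mu$ is induced by $\widehat F$ if and only if, for every set $X$ and every $\mathcal V$-relation $f\colon X\nrightarrow\kappa$, $$\mu(f)=\mu(1_\kappa)\cdot\widehat F(f).$$
   Context: A quantale $\mathcal V$ is a complete lattice with a commutative monoid structure $(\otimes,k)$ such that each $u\otimes-$ preserves suprema. A $\mathcal V$-relation $r\colon X\nrightarrow Y$ is a map $X\times Y\to\mathcal V$. For $r\colon X\nrightarrow Y$, $s\colon Y\nrightarrow Z$, the composite is $(s\cdot r)(x,z)=\bigvee_{y}r(x,y)\otimes s(y,z)$; $1_X$ has value $k$ on the diagonal and $\bot$ elsewhere; $\mathcal V\text{-}\mathsf{Rel}$ is the category of sets and $\mathcal V$-relations. $\mathcal V$-relations are ordered pointwise; $r^\circ(y,x)=r(x,y)$ is the converse. A function $f\colon X\to Y$ is regarded as the $\mathcal V$-relation with value $k$ on the graph of $f$ and $\bot$ elsewhere. A lax extension of $F$ to $\mathcal V\text{-}\mathsf{Rel}$ is an assignment $(r\colon X\nrightarrow Y)\mapsto(\widehat Fr\colon FX\nrightarrow FY)$ such that (L1) $r\le r'$ implies $\widehat Fr\le\widehat Fr'$; (L2) $\widehat Fs\cdot\widehat Fr\le\widehat F(s\cdot r)$; (L3) $Ff\le\widehat Ff$ and $(Ff)^\circ\le\widehat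 F(f^\circ)$ for all functions $f$. A $\kappa$-ary predicate lifting $\mu$ for $F$ is a family of maps sending $\mathcal V$-relations $r\colon X\nrightarrow\kappa$ to $\mathcal V$-relations $\mu(r)\colon FX\nrightarrow1$, natural in $X$: $\mu(r\cdot f)=\mu(r)\cdot Ff$ for all functions $f\colon X\to Y$ and $r\colon Y\nrightarrow\kappa$ (equivalently, via currying, a natural transformation $\mathsf{Set}(-,\mathcal V^\kappa)\to\mathsf{Set}(F-,\mathcal V)$). It is induced by $\widehat F$ if there is a $\mathcal V$-relation $\mathfrak r\colon F\kappa\nrightarrow1$ such that $\mu(f)=\mathfrak r\cdot\widehat Ff$ for every $\mathcal V$-relation $f\colon X\nrightarrow\kappa$. *)

(* Defs.v *)
From HB Require Import structures.
From mathcomp Require Import all_boot all_order.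
From mathcomp Require Import boolp classical_sets.

Set Implicit Arguments.
Unset Strict Implicit.
Unset Printing Implicit Defensive.

Import Order.TTheory.
Local Open Scope classical_set_scope.
Local Open Scope order_scope.

HB.mixin Record TBLattice_isComplete d V of Order.TBLattice d V := {
  supremums_nonempty : forall A : set V, supremums A !=set0
}.

#[short(type="completeLatticeType")]
HB.structure Definition CompleteLattice d :=
  {V of TBLattice_isComplete d V & Order.TBLattice d V}.

(* The default value \bot of supremum is only reached at the empty set, where
   it is the least upper bound: see bigsup_isLub. *)
Definition bigsup d (V : completeLatticeType d) (A : set V) : V :=
  supremum \bot A.

Lemma bigsup_isLub d (V : completeLatticeType d) (A : set V) :
  isLub A (bigsup A).
Proof.
rewrite /bigsup /supremum; case: eqP => [->|_].
  by split=> [x []|b _]; exact: le0x.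
case: xgetP => [m _ [Am mA]|Anone]; first by split.
by have [m /Anone] := supremums_nonempty A.
Qed.

HB.mixin Record CompleteLattice_isQuantale d V of CompleteLattice d V := {
  tensor : V -> V -> V;
  qunit : V;
  tensorA : associative tensor;
  tensorC : commutative tensor;
  tensor1q : left_id qunit tensor;
  tensor_bigsupr :
    forall (u : V) (A : set V), tensor u (bigsup A) = bigsup (tensor u @` A)
}.

#[short(type="quantaleType")]
HB.structure Definition Quantale d :=
  {V of CompleteLattice_isQuantale d V & CompleteLattice d V}.

Arguments qunit {d} V : rename.

HB.instance Definition _ d (V : quantaleType d) :=
  Monoid.isComLaw.Build V (qunit V) tensor tensorA tensorC tensor1q.

Definition vrel (V X Y : Type) : Type := X -> Y -> V.

Declare Scope vrel_scope.
Delimit Scope vrel_scope with vrel.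
Bind Scope vrel_scope with vrel.

Section VRelations.
Context {d : Order.disp_t} {V : quantaleType d}.

Definition vrel_comp {X Y Z : Type} (s : vrel V Y Z) (r : vrel V X Y) :
    vrel V X Z :=
  fun x z => bigsup (range (fun y : Y => tensor (r x y) (s y z))).

Definition vrel_id (X : Type) : vrel V X X :=
  fun x x' => if `[< x = x' >] then qunit V else \bot.

Definition vrel_le {X Y : Type} (r r' : vrel V X Y) : Prop :=
  forall x y, r x y <= r' x y.

Definition vrel_conv {X Y : Type} (r : vrel V X Y) : vrel V Y X :=
  fun y x => r x y.

Definition vrel_fun {X Y : Type} (f : X -> Y) : vrel V X Y :=
  fun x y => if `[< f x = y >] then qunit V else \bot.

End VRelations.

Arguments vrel_id {d V} X _ _.

(* As in the mathematical convention, s ⋅ r is "r first, then s". *)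
Notation "s ⋅ r" := (vrel_comp s r)
  (at level 40, left associativity) : vrel_scope.
Notation "r ≤ r'" := (vrel_le r r') (at level 70) : vrel_scope.
Notation "r ^°" := (vrel_conv r) (at level 2, format "r ^°") : vrel_scope.

Local Open Scope vrel_scope.

Record set_functor := SetFunctor {
  fobj :> Type -> Type;
  fmap : forall X Y : Type, (X -> Y) -> fobj X -> fobj Y;
  fmap_id : forall X : Type, fmap (@id X) = id;
  fmap_comp : forall (X Y Z : Type) (g : Y -> Z) (f : X -> Y),
    fmap (g \o f) = fmap g \o fmap f
}.

Arguments fmap F {X Y} f : rename.

Record lax_extension d (V : quantaleType d) (F : set_functor) := LaxExtension {
  lax_map :> forall X Y : Type, vrel V X Y -> vrel V (F X) (F Y);
  lax_mono : forall (X Y : Type) (r r' : vrel V X Y),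
    r ≤ r' -> lax_map r ≤ lax_map r';
  lax_comp : forall (X Y Z : Type) (s : vrel V Y Z) (r : vrel V X Y),
    (lax_map s ⋅ lax_map r) ≤ lax_map (s ⋅ r);
  lax_fun : forall (X Y : Type) (f : X -> Y),
    vrel_fun (fmap F f) ≤ lax_map (vrel_fun f);
  lax_fun_conv : forall (X Y : Type) (f : X -> Y),
    (vrel_fun (fmap F f))^° ≤ lax_map (vrel_fun f)^°
}.

(* The arity kappa is an arbitrary type, standing for a set of that
   cardinality; unit is the one-element set 1. *)
Record predicate_lifting d (V : quantaleType d) (F : set_functor)
    (kappa : Type) := PredicateLifting {
  lifting_map :> forall X : Type, vrel V X kappa -> vrel V (F X) unit;
  lifting_natural : forall (X Y : Type) (f : X -> Y) (r : vrel V Y kappa),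
    lifting_map (r ⋅ vrel_fun f) = lifting_map r ⋅ vrel_fun (fmap F f)
}.


Definition induced_by d (V : quantaleType d) (F : set_functor)
    (Fhat : lax_extension V F) (kappa : Type)
    (mu : predicate_lifting V F kappa) : Prop :=
  exists rr : vrel V (F kappa) unit,
    forall (X : Type) (f : vrel V X kappa), mu X f = rr ⋅ Fhat X kappa f.

(* Main.v *)
Require Import Defs.
From mathcomp Require Import all_boot all_order.
From mathcomp Require Import boolp classical_sets.
Local Open Scope vrel_scope.

(** If [mu] is induced by [rr], then [mu(1) = rr ⋅ Fhat 1], so associativity
    of composition turns [mu(1) ⋅ Fhat f] into [rr ⋅ (Fhat 1 ⋅ Fhat f)]. A lax
    extension need not preserve identities, but [Fhat 1] still acts as an
    identity on the left of every [Fhat f] ([lax_map_id_absorb]), which gives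
    [rr ⋅ Fhat f = mu(f)]. Conversely, the equation says that [mu(1)] itself
    induces [mu]. *)

Import Order.TTheory.
Section QuantaleRelations.
Local Open Scope classical_set_scope.
Local Open Scope order_scope.
Local Set Implicit Arguments.
Local Unset Strict Implicit.
Context {d : Order.disp_t} {V : quantaleType d}.

Lemma bigsup_range_ub (I : Type) (f : I -> V) (i : I) :
  f i <= bigsup (range f).
Proof. by apply: (bigsup_isLub (range f)).1; exists i. Qed.

Lemma bigsup_range_le (I : Type) (f : I -> V) (w : V) :
  (forall i, f i <= w) -> bigsup (range f) <= w.
Proof.
by move=> fw; apply: (bigsup_isLub (range f)).2 => _ [i _ <-].
Qed.

Lemma tensor_bigsup_range_le (I : Type) (u w : V) (f : I -> V) :
  (forall i, tensor u (f i) <= w) -> tensor u (bigsup (range f)) <= w.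
Proof.
move=> fw; rewrite tensor_bigsupr.
by apply: (bigsup_isLub _).2 => _ [_ [i _ <-] <-].
Qed.

Lemma tensorq0 (u : V) : tensor u \bot = \bot.
Proof.
have bigsup0 : bigsup set0 = \bot :> V.
  by apply/eqP; rewrite -lex0; apply: (bigsup_isLub set0).2 => x [].
by rewrite -bigsup0 tensor_bigsupr image_set0.
Qed.

(** When [v <= w], the element [w] is the supremum of [[set v; w]], and
    [tensor u] preserves this supremum. *)
Lemma tensor_le2l (u v w : V) : v <= w -> tensor u v <= tensor u w.
Proof.
move=> vw; have <- : bigsup [set v; w] = w.
  have [ub least] := bigsup_isLub [set v; w].
  apply/le_anti/andP; split; last by apply: ub; right.
  by apply: least => x [->|->].
by rewrite tensor_bigsupr; apply: (bigsup_isLub _).1; exists v => //; left.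
Qed.

Lemma tensor_le2r (u v w : V) : v <= w -> tensor v u <= tensor w u.
Proof. by rewrite ![tensor _ u]tensorC; exact: tensor_le2l. Qed.

Lemma vrel_le_anti (X Y : Type) (r s : vrel V X Y) : r ≤ s -> s ≤ r -> r = s.
Proof.
move=> rs sr; apply/funext => x; apply/funext => y.
by apply/le_anti; rewrite rs sr.
Qed.

Lemma vrel_comp_lel (X Y Z : Type) (s s' : vrel V Y Z) (r : vrel V X Y) :
  s ≤ s' -> (s ⋅ r) ≤ (s' ⋅ r).
Proof.
move=> ss' x z; apply: bigsup_range_le => y.
by apply: le_trans (bigsup_range_ub _ y); exact: tensor_le2l.
Qed.

Lemma vrel_compA (X Y Z W : Type) (t : vrel V Z W) (s : vrel V Y Z)
    (r : vrel V X Y) :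
  t ⋅ (s ⋅ r) = (t ⋅ s) ⋅ r.
Proof.
apply: vrel_le_anti => x w; apply: bigsup_range_le.
- move=> z; rewrite tensorC; apply: tensor_bigsup_range_le => y.
  rewrite tensorC -tensorA; apply: le_trans (bigsup_range_ub _ y).
  by apply: tensor_le2l; exact: (bigsup_range_ub _ z).
- move=> y; apply: tensor_bigsup_range_le => z.
  rewrite tensorA; apply: le_trans (bigsup_range_ub _ z).
  by apply: tensor_le2r; exact: (bigsup_range_ub _ y).
Qed.

Lemma vrel_comp1r (X Y : Type) (r : vrel V X Y) : vrel_id Y ⋅ r = r.
Proof.
apply: vrel_le_anti => x y.
- apply: bigsup_range_le => y'; rewrite /vrel_id.
  case: asboolP => [->|_]; first by rewrite tensorC tensor1q.
  by rewrite tensorq0 le0x.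
- apply: le_trans (bigsup_range_ub _ y).
  by rewrite /vrel_id asboolT // tensorC tensor1q.
Qed.

Lemma lax_map_id_ge (F : set_functor) (Fhat : lax_extension V F) (X : Type) :
  vrel_id (F X) ≤ Fhat X X (vrel_id X).
Proof. by have := lax_fun Fhat (@id X); rewrite fmap_id. Qed.

(** The identity is only laxly preserved, [1 ≤ Fhat 1], but this is the
    inequality needed for [Fhat f ≤ Fhat 1 ⋅ Fhat f]; the other one is the lax
    functoriality [Fhat 1 ⋅ Fhat f ≤ Fhat (1 ⋅ f)]. *)
Lemma lax_map_id_absorb (F : set_functor) (Fhat : lax_extension V F)
    (X Y : Type) (f : vrel V X Y) :
  Fhat Y Y (vrel_id Y) ⋅ Fhat X Y f = Fhat X Y f.
Proof.
apply: vrel_le_anti.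
- by have := lax_comp Fhat (vrel_id Y) f; rewrite vrel_comp1r.
- by rewrite -{1}[Fhat X Y f]vrel_comp1r; exact/vrel_comp_lel/lax_map_id_ge.
Qed.

End QuantaleRelations.

Theorem theorem3p9 (d : Order.disp_t) (V : quantaleType d) (F : set_functor)
    (Fhat : lax_extension V F) (kappa : Type)
    (mu : predicate_lifting V F kappa) :
  induced_by Fhat mu <->
  forall (X : Type) (f : vrel V X kappa),
    mu X f = mu kappa (vrel_id kappa) ⋅ Fhat X kappa f.
Proof.
split=> [[rr mu_rr] X f|mu_id]; last by exists (mu kappa (vrel_id kappa)).
by rewrite !mu_rr -vrel_compA lax_map_id_absorb.
Qed.
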